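(* Let $\Gamma$ be a finite, simple, connected, bipartite $k$-regular graph with $n$ vertices whose adjacency spectrum is $\{[\pm k]^{1}, [\pm\theta]^{\frac{n}{2}-1}\}$, where $\frac{n}{2}-1\geq 1$ and the four displayed eigenvalues $k,-k,\theta,-\theta$ are pairwise distinct. Then $\Gamma$ is periodic if and only if $\Gamma$ is isomorphic to the cycle graph $C_6$ on $6$ vertices.
   Context: All graphs are finite, simple and connected. The adjacency spectrum of a graph is the multiset of eigenvalues of its adjacency matrix. The notation $\{[\pm k]^{1}, [\pm\theta]^{a}\}$ means that $k$ and $-k$ each have multiplicity $1$, and $\theta$ and $-\theta$ each have multiplicity $a$. Grover walk and periodicity: for a graph $\Gamma=(V,E)$, let $\mathcal{A}=\{(x,y),(y,x)\mid \{x,y\}\in E\}$ be its set of arcs; for $e=(x,y)\in\mathcal{A}$ write $t(e)=y$ for the terminus and $e^{-1}=(y,x)$ for the inverse arc. The boundary matrix $d\in\mathbb{C}^{V\times\mathcal{A}}$ is $d_{x,e}=\frac{1}{\sqrt{\deg x}}\delta_{x,t(e)}$, the shift matrix $S\in\mathbb{C}^{\mathcal{A}\times\mathcal{A}}$ is $S_{e,f}=\delta_{e,f^{-1}}$, and the time evolution matrix is $U=S(2d^*d-I)\in\mathbb{C}^{\mathcal{A}\times\mathcal{A}}$, where $d^*$ is the conjugate transpose of $d$ and $\delta$ is the Kronecker delta. The graph $\Gamma$ is called periodic if there exists a positive integer $\tau$ with $U^{\tau}=I$. *)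

(* Defs.v *)
From mathcomp Require Import all_boot all_order all_algebra.
From mathcomp Require Import reals complex.

Set Implicit Arguments.
Unset Strict Implicit.
Unset Printing Implicit Defensive.

Import Order.TTheory GRing.Theory Num.Theory.
Local Open Scope ring_scope.

Record sgraph := SGraph {
  vertex :> finType;
  adj : rel vertex;
  adj_sym : symmetric adj;
  adj_irr : irreflexive adj
}.

Section Graphs.

Variable G : sgraph.

Definition deg (x : G) : nat := #|[set y | adj x y]|.

Definition regular (k : nat) : Prop := forall x : G, deg x = k.

Definition connected_graph : Prop :=
  (0 < #|G|)%N /\ forall x y : G, connect (@adj G) x y.

Definition bipartite : Prop :=
  exists A : {set G}, forall x y : G, adj x y -> (x \in A) != (y \in A).

Definition adjmx (R : realType) : 'M[R]_#|G| :=
  \matrix_(i, j) (adj (enum_val i) (enum_val j))%:R.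

(* The sequence s, read up to permutation, is the multiset of eigenvalues
   counted with multiplicity as roots of the characteristic polynomial. *)
Definition adj_spectrum (R : realType) (s : seq R) : Prop :=
  char_poly (adjmx R) = \prod_(a <- s) ('X - a%:P).

Definition garc : finType := {p : G * G | adj p.1 p.2}.

Definition origin (e : garc) : G := (val e).1.
Definition terminus (e : garc) : G := (val e).2.

Lemma arc_inv_subproof (e : garc) : adj (terminus e) (origin e).
Proof. by rewrite adj_sym; exact: (valP e). Qed.

Definition arc_inv (e : garc) : garc :=
  exist (fun p : G * G => adj p.1 p.2) (terminus e, origin e)
    (arc_inv_subproof e).

Variable R : realType.

(* Rows and columns indexed by vertices or arcs go through enum_val. *)
Definition boundary : 'M[R[i]]_(#|G|, #|garc|) :=
  \matrix_(x, e) ((sqrtC (deg (enum_val x))%:R)^-1 *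
                  (enum_val x == terminus (enum_val e))%:R).

Definition shift : 'M[R[i]]_#|garc| :=
  \matrix_(e, f) (enum_val e == arc_inv (enum_val f))%:R.

Definition evolution : 'M[R[i]]_#|garc| :=
  shift *m (2%:R *: (boundary ^t*%sesqui *m boundary) - 1%:M).

Definition periodic : Prop :=
  exists tau : nat, (0 < tau)%N /\ evolution ^+ tau = 1%:M.

End Graphs.

Definition isomorphic (G H : sgraph) : Prop :=
  exists f : G -> H, bijective f /\ forall x y, adj (f x) (f y) = adj x y.

Definition cycle_adj (n : nat) : rel 'I_n :=
  fun i j => (j == i.+1 %% n :> nat)%N || (i == j.+1 %% n :> nat)%N.

Lemma cycle_adj_sym n : symmetric (@cycle_adj n).
Proof. by move=> i j; rewrite /cycle_adj orbC. Qed.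

Lemma cycle_adj_irr n : (2 < n)%N -> irreflexive (@cycle_adj n).
Proof.
move=> n_gt2 i; rewrite /cycle_adj orbb; apply/negbTE.
have := ltn_ord i; rewrite leq_eqVlt => /orP[/eqP iE|lt_in].
  by rewrite iE modnn; apply/eqP => i0; move: iE n_gt2; rewrite i0 => <-.
by rewrite modn_small // neq_ltn ltnSn.
Qed.

Definition cycle_graph (n : nat) (n_gt2 : (2 < n)%N) : sgraph :=
  SGraph (@cycle_adj_sym n) (cycle_adj_irr n_gt2).

Definition C6 : sgraph := @cycle_graph 6 isT.

(* Main.v *)
Require Import Defs.
From mathcomp Require Import all_boot all_order all_algebra all_fingroup.
From mathcomp Require Import all_field reals complex.
From mathcomp Require Import zify ring lra.

(* If U^tau = 1, then x = 2 theta / k is a sum mu + mu^-1 of two inverse roots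
   of unity, so x^2 - 2 = mu^2 + mu^-2 is an algebraic integer.  The trace of
   A^2 gives (n/2) k = k^2 + (n/2 - 1) theta^2, hence q = x^2 is rational, and
   therefore an integer, with 0 < q.  If k = 1 then theta = 1 or - 1, which is
   excluded; otherwise q (n/2 - 1) k = 4 (n/2 - k) leaves only (k, n) = (2, 6),
   and (3, 18) where theta = 3/2 or - 3/2 would not be an
   algebraic integer.  A connected 2-regular graph on 6 vertices is C_6.
   Conversely, on a 2-regular graph U is a permutation matrix: it moves every
   arc one step along its cycle. *)

Set Implicit Arguments.
Unset Strict Implicit.
Unset Printing Implicit Defensive.

Import Order.TTheory GRing.Theory Num.Theory.
Local Open Scope ring_scope.
Local Open Scope complex_scope.

(** * Algebraic integrality through monic integer polynomials *)

(** A rational root over [F] is already a root over [rat], hence over [algC], where a rational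
    algebraic integer is an integer. *)
Lemma monic_int_root_rat (F : numFieldType) (p : {poly int}) (y : rat) :
  p \is monic -> root (map_poly intr p) (ratr y : F) ->
  exists m : int, y = m%:~R.
Proof.
move=> p_mon.
have rE (K : numFieldType) : root (map_poly intr p) (ratr y : K) =
    root (map_poly intr p) y.
  rewrite -(fmorph_root (ratr : {rmorphism rat -> K})) -map_poly_comp.
  by congr (root _ _); apply: eq_map_poly => c /=; rewrite ratr_int.
rewrite rE -(rE algC) => /root_monic_Aint yA.
have /intrP[m /eqP] : (ratr y : algC) \is a Num.int.
  apply: Cint_rat_Aint; first exact: Crat_rat.
  apply: yA; first exact: monic_map.
  by apply/polyOverP => i; rewrite coef_map /= rpred_int.
by rewrite -ratr_int (inj_eq (fmorph_inj _)) => /eqP ->; exists m.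
Qed.

(* Here p is C_(m+1), where C_i (x + 1/x) = x^i + x^(-i). *)
Lemma sum_powers_monic_int (F : fieldType) (n : nat) (X Y : 'M[F]_n)
    (b : 'rV[F]_n) (z : F) (m : nat) :
  X * Y = 1 -> Y * X = 1 -> b *m (X + Y) = z *: b ->
  exists p : {poly int}, [/\ p \is monic, size p = m.+2 &
    b *m (X ^+ m.+1 + Y ^+ m.+1) = (map_poly intr p).[z] *: b].
Proof.
move=> XY YX bz.
(* The recurrence has order two, so the induction carries [C_(m+1)] and [C_(m+2)] together. *)
suff [p [_ [p_mon sp bp _]]] : exists p q : {poly int}, [/\ p \is monic,
    size p = m.+2, b *m (X ^+ m.+1 + Y ^+ m.+1) = (map_poly intr p).[z] *: b &
    [/\ q \is monic, size q = m.+3 &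
    b *m (X ^+ m.+2 + Y ^+ m.+2) = (map_poly intr q).[z] *: b]].
  by exists p.
have rec i : b *m (X ^+ i.+2 + Y ^+ i.+2) =
    z *: (b *m (X ^+ i.+1 + Y ^+ i.+1)) - b *m (X ^+ i + Y ^+ i).
  rewrite scalemxAl -bz -mulmxA -mulmxBr; congr (_ *m _).
  rewrite -[(X + Y) *m _]/((X + Y) * _) mulrDl !mulrDr -!exprS.
  rewrite [in X * _]exprS mulrA XY mul1r [_ ^+ i.+1]exprS mulrA YX mul1r.
  by rewrite [X ^+ i + Y ^+ i.+2]addrC addrACA [Y ^+ i + X ^+ i]addrC addrK.
elim: m => [|m [p [q [p_mon sp bp [q_mon sq bq]]]]].
  have s2 : (size (2%:P : {poly int})%R < size ('X^2 : {poly int})%R)%N.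
    by rewrite size_polyXn (leq_ltn_trans (size_polyC_leq1 _)).
  exists 'X, ('X^2 - 2%:P); split; rewrite ?monicX ?size_polyX //.
    rewrite !expr1 map_polyX hornerX; exact: bz.
  split.
  - by rewrite monicE lead_coefDl ?size_polyN // lead_coefXn.
  - by rewrite size_polyDl ?size_polyN // size_polyXn.
  rewrite rec !expr1 !expr0 bz rmorphB /= map_polyXn map_polyC !hornerE.
  by rewrite mulmxDr mulmx1 scalerBl scalerA expr2 scalerDl scale1r.
exists q, ('X * q - p); split=> //.
have sXq : size ('X * q) = m.+4.
  by rewrite mulrC size_mulX ?sq // -size_poly_gt0 sq.
split.
- rewrite monicE lead_coefDl ?size_polyN ?sXq ?sp //.
  by rewrite lead_coefM lead_coefX mul1r -monicE.
- by rewrite size_polyDl ?size_polyN ?sXq ?sp.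
by rewrite rec bp bq rmorphB rmorphM /= map_polyX !hornerE scalerBl scalerA.
Qed.

(** Also [Y^(m+1) = 1], so [C_(m+1) (z) b = 2 b] and [z] is a root of [C_(m+1) - 2], still monic
    because [C_(m+1)] is not constant. *)
Lemma finite_order_sum_monic_int (F : fieldType) (n : nat) (X Y : 'M[F]_n)
    (b : 'rV[F]_n) (z : F) (m : nat) :
  X * Y = 1 -> Y * X = 1 -> b *m (X + Y) = z *: b -> b != 0 ->
  X ^+ m.+1 = 1 ->
  exists2 p : {poly int}, p \is monic & root (map_poly intr p) z.
Proof.
move=> XY YX bz b0 Xm.
have Ym : Y ^+ m.+1 = 1.
  by rewrite -[LHS]mul1r -Xm -exprMn_comm ?XY ?expr1n // /GRing.comm XY YX.
have [p [p_mon sp]] := sum_powers_monic_int m XY YX bz.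
rewrite Xm Ym mulmxDr !mulmx1 -mulr2n -scaler_nat => bE.
exists (p - 2%:P).
  rewrite monicE lead_coefDl -?monicE // size_polyN sp.
  by rewrite (leq_ltn_trans (size_polyC_leq1 _)).
rewrite /root rmorphB /= map_polyC !hornerE subr_eq0 eq_sym -subr_eq0.
by have/eqP := bE; rewrite -subr_eq0 -scalerBl scaler_eq0 (negPf b0) orbF.
Qed.

(** * Trace of the square of a matrix *)

Lemma map_comp_poly_polyC (F : comNzRingType) (n : nat) (q : {poly F})
    (A : 'M[F]_n) :
  map_mx (comp_poly q) (map_mx polyC A) = map_mx polyC A.
Proof. by apply/matrixP => i j; rewrite !mxE comp_polyC. Qed.

(* Substituting X^2 turns the claim into
   det (X - A) * det (- X - A) = det (A^2 - X^2). *)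
Lemma char_poly_mxsqr (F : idomainType) (n : nat) (A : 'M[F]_n) (s : seq F) :
  char_poly A = \prod_(a <- s) ('X - a%:P) ->
  char_poly (A *m A) = \prod_(a <- s) ('X - (a ^+ 2)%:P).
Proof.
move=> Es.
have sz : size s = n.
  by apply/eqP; rewrite -eqSS -(size_prod_XsubC s id) -Es size_char_poly.
suff E : char_poly (A *m A) \Po 'X^2 =
    (\prod_(a <- s) ('X - (a ^+ 2)%:P)) \Po 'X^2.
  (* Substituting [X^2] moves the coefficient of degree [i] to degree [2 i], so nothing is lost. *)
  apply/polyP => i; have := congr1 (fun p : {poly F} => p`_(2 * i)) E.
  by rewrite !coef_comp_poly_Xn // dvdn_mulr // mulKn.
(* The sign comes from [det (A^2 - X^2) = (-1)^n det (X^2 - A^2)]. *)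
apply: (@mulfI _ ((-1) ^+ n)); first by rewrite signr_eq0.
transitivity (char_poly A * (char_poly A \Po - 'X)).
  rewrite /char_poly -!det_map_mx /char_poly_mx !map_mxB !map_scalar_mx /=.
  rewrite !map_comp_poly_polyC !comp_polyX -detZ -det_mulmx map_mxM.
  rewrite mulmxBl !mulmxBr !mul_scalar_mx !mul_mx_scalar -scalemx1.
  congr (\det _); apply/matrixP => i j; rewrite !mxE; ring.
rewrite Es !(rmorph_prod (comp_poly _)) -sz.
(* Each root uses up one sign: [(X - a) (- X - a) = - (X^2 - a^2)]. *)
elim: s {Es sz} => [|a s IHs]; first by rewrite !big_nil !mulr1.
rewrite !big_cons /= mulrACA IHs [_ ^+ (size s).+1]exprS /=.
by rewrite !comp_polyB !comp_polyC !comp_polyX polyC_exp; ring.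
Qed.

(** The trace is minus the subleading coefficient of the characteristic polynomial, read here for
    [A^2]; the empty matrix is treated apart. *)
Lemma mxtrace_sqr_prod (F : idomainType) (n : nat) (A : 'M[F]_n) (s : seq F) :
  char_poly A = \prod_(a <- s) ('X - a%:P) ->
  \tr (A *m A) = \sum_(a <- s) a ^+ 2.
Proof.
move=> Es.
have sz : size s = n.
  by apply/eqP; rewrite -eqSS -(size_prod_XsubC s id) -Es size_char_poly.
case: n A Es sz => [|n] A Es sz.
  by rewrite (size0nil sz) big_nil /mxtrace big_ord0.
apply: oppr_inj; rewrite -char_poly_trace // (char_poly_mxsqr Es).
have := @coefPn_prod_XsubC _ [seq a ^+ 2 | a <- s].
by rewrite size_map sz !big_map => ->.
Qed.

(** * Boundary, shift and adjacency matrices *)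

Lemma sum_enum_val (V : nmodType) (T : finType) (F : T -> V) :
  \sum_(i < #|T|) F (enum_val i) = \sum_x F x.
Proof.
rewrite [RHS](reindex (@enum_val T T)) //.
by apply: onW_bij; exact: enum_val_bij.
Qed.

Lemma sum_adj (R : nzRingType) (G : sgraph) (x : G) :
  \sum_y (adj x y)%:R = (deg x)%:R :> R.
Proof.
rewrite /deg cardsE -sum1_card (big_morph _ (@natrD _) (mulr0n 1)).
rewrite [RHS]big_mkcond; apply: eq_bigr => y _.
by rewrite -topredE /=; case: (adj _ _).
Qed.

(** A diagonal entry of [A^2] counts the neighbours of a vertex. *)
Lemma mxtrace_sqr_adj (G : sgraph) (R : realType) (k : nat) :
  regular G k -> \tr (adjmx G R *m adjmx G R) = (#|G| * k)%:R.
Proof.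
move=> reg; rewrite /mxtrace.
transitivity (\sum_(i < #|G|) (k%:R : R)).
  apply: eq_bigr => i _; rewrite mxE -(reg (enum_val i)) -sum_adj.
  rewrite -[RHS]sum_enum_val.
  by apply: eq_bigr => j _; rewrite !mxE adj_sym -natrM mulnb andbb adj_sym.
by rewrite big_const_ord iter_addr_0 mulnC natrM mulr_natr.
Qed.

Lemma sum_garc (V : nmodType) (G : sgraph) (F : G -> G -> V) :
  \sum_(e : garc G) F (origin e) (terminus e) = \sum_x \sum_(y | adj x y) F x y.
Proof.
rewrite pair_big_dep /=.
by rewrite [RHS](big_sub ([pred p : G * G | adj p.1 p.2])).
Qed.

(** Conjugation disappears because [1 / sqrt k] is real. *)
Lemma boundary_adjE (G : sgraph) (R : realType) (k : nat) e x : regular G k ->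
  (boundary G R)^t*%sesqui e x =
    (sqrtC k%:R)^-1 * (enum_val x == terminus (enum_val e))%:R.
Proof.
move=> reg; rewrite !mxE reg rmorphM rmorph_nat fmorphV; congr (_^-1 * _).
by apply/CrealP; rewrite ger0_real // sqrtC_ge0 ler0n.
Qed.

Lemma invsqrtCM (C : numClosedFieldType) (x : C) :
  (sqrtC x)^-1 * (sqrtC x)^-1 = x^-1.
Proof. by rewrite -invfM -expr2 sqrtCK. Qed.

Lemma boundary_adjM (G : sgraph) (R : realType) (k : nat) (e f : 'I_#|garc G|) :
  regular G k ->
  ((boundary G R)^t*%sesqui *m boundary G R) e f =
    k%:R^-1 * (terminus (enum_val e) == terminus (enum_val f))%:R.
Proof.
move=> reg; rewrite mxE.
under eq_bigr => x _ do
  rewrite (boundary_adjE _ _ _ reg) mxE reg mulrACA invsqrtCM -natrM mulnb.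
rewrite -mulr_sumr; congr (_ * _).
rewrite (sum_enum_val (fun x => ((x == _) && (x == _))%:R)).
rewrite (bigD1 (terminus (enum_val e))) //= eqxx big1 ?addr0 // => x.
by move/negPf->.
Qed.

(** Row [x] of [d] has [k] entries [1 / sqrt k], at the arcs ending at [x]; distinct rows have
    disjoint supports. *)
Lemma boundaryM_adj (G : sgraph) (R : realType) (k : nat) :
  (0 < k)%N -> regular G k ->
  boundary G R *m (boundary G R)^t*%sesqui = 1%:M.
Proof.
move=> k_gt0 reg; apply/matrixP => x y; rewrite [LHS]mxE.
under eq_bigr => e _ do
  rewrite (boundary_adjE _ _ _ reg) mxE reg mulrACA invsqrtCM -natrM mulnb.
rewrite -mulr_sumr.
rewrite (sum_enum_val
  (fun e : garc G => ((_ == terminus e) && (_ == terminus e))%:R)).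
rewrite (sum_garc (fun _ b => ((enum_val x == b) && (enum_val y == b))%:R)).
have -> : \sum_a \sum_(b | adj a b) ((enum_val x == b) && (enum_val y == b))%:R
    = (x == y)%:R * \sum_a (adj (enum_val x) a)%:R :> R[i].
  rewrite mulr_sumr; apply: eq_bigr => a _; rewrite -natrM mulnb.
  rewrite big_mkcond (bigD1 (enum_val x)) //= eqxx (inj_eq enum_val_inj) /=.
  rewrite [adj (enum_val x) a]adj_sym eq_sym big1 ?addr0 => [|b]; last first.
    by rewrite eq_sym => /negPf->; rewrite if_same.
  by case: (adj _ _); rewrite ?andbT ?andbF.
by rewrite sum_adj reg mxE mulrCA mulVf ?mulr1 // pnatr_eq0 -lt0n.
Qed.

(** Entry [(x, y)] sums [1 / k] over the arcs with origin [x] and terminus [y], of which there is at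
    most one. *)
Lemma boundary_shift_adj (G : sgraph) (R : realType) (k : nat) :
  regular G k ->
  boundary G R *m shift G R *m (boundary G R)^t*%sesqui =
    k%:R^-1 *: map_mx (real_complex R) (adjmx G R).
Proof.
move=> reg; apply/matrixP => x y; rewrite [LHS]mxE.
under eq_bigr => f _.
  rewrite (boundary_adjE _ _ _ reg) mxE.
  (* Column [f] of [S] selects [f^-1], whose terminus is the origin of [f]. *)
  rewrite (bigD1 (enum_rank (arc_inv (enum_val f)))) //= !mxE enum_rankK eqxx.
  rewrite mulr1 big1 ?addr0 ?reg; last first.
    move=> e /negPf ne.
    by rewrite !mxE (can2_eq (@enum_valK _) (@enum_rankK _) e) ne mulr0.
  rewrite mulrACA invsqrtCM -natrM mulnb.
  over.
rewrite -mulr_sumr 3!mxE /= rmorph_nat; congr (_ * _).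
rewrite (sum_enum_val
  (fun e : garc G => ((_ == origin e) && (_ == terminus e))%:R)).
rewrite (sum_garc (fun a b => ((enum_val x == a) && (enum_val y == b))%:R)).
rewrite (bigD1 (enum_val x)) //= [X in _ + X]big1 => [|a]; last first.
  by rewrite eq_sym => /negPf xa; apply: big1 => b _; rewrite xa.
rewrite addr0 eqxx /= big_mkcond (bigD1 (enum_val y)) //= eqxx big1 => [|b].
  by rewrite addr0; case: (adj _ _).
by rewrite eq_sym => /negPf->; rewrite if_same.
Qed.

(** * The shift as an involution, and eigenvalues under periodicity *)

Lemma arc_invK (G : sgraph) : involutive (@arc_inv G).
Proof. by move=> -[[x y] xy]; exact: val_inj. Qed.

Lemma shift_sqr (G : sgraph) (R : realType) : shift G R *m shift G R = 1%:M.
Proof.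
apply/matrixP => e f; rewrite mxE.
rewrite (bigD1 (enum_rank (arc_inv (enum_val f)))) //=.
rewrite !mxE enum_rankK arc_invK eqxx mulr1 (inj_eq enum_val_inj).
rewrite big1 ?addr0 // => g /negPf ne.
by rewrite !mxE (can2_eq (@enum_valK _) (@enum_rankK _) g) ne mulr0.
Qed.

(* If u is an eigenvector of the adjacency matrix, then b = u d S satisfies
   b (U + U^-1) = (2 theta / k) b.  Squaring U makes the eigenvalue rational in
   theta^2. *)
Lemma periodic_eigenvalue (G : sgraph) (R : realType) (k : nat) (theta : R) :
  (0 < k)%N -> regular G k -> periodic G R -> eigenvalue (adjmx G R) theta ->
  exists2 p : {poly int}, p \is monic &
    root (map_poly intr p) ((2 * theta / k%:R) ^+ 2 - 2).
Proof.
move=> k_gt0 reg [[|tau] [//= _ Utau]] /eigenvalueP[u0 u0A u0_neq0].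
pose c := 2 * theta / k%:R.
pose u := map_mx (real_complex R) u0.
pose d := boundary G R; pose S := shift G R.
pose ds := (boundary G R)^t*%sesqui; pose U := evolution G R.
have dds : d *m ds = 1%:M := boundaryM_adj R k_gt0 reg.
pose a := u *m d; pose b := a *m S.
have UE (w : 'rV_#|garc G|) : w *m U = 2 *: (w *m S *m ds *m d) - w *m S.
  by rewrite /U /evolution mulmxA mulmxBr mulmx1 -scalemxAr mulmxA.
have bU : b *m U = a.
  rewrite UE /b -(mulmxA a S S) shift_sqr mulmx1 /a -(mulmxA u d ds) dds mulmx1.
  by rewrite scaler_nat mulr2n addrK.
have aU : a *m U = c%:C *: a - b.
  have aSds : a *m S *m ds = (theta / k%:R)%:C *: u.
    rewrite /a -(mulmxA u) -(mulmxA u) (boundary_shift_adj R reg) -scalemxAr.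
    rewrite -map_mxM u0A map_mxZ scalerA mulrC.
    by rewrite [in RHS]rmorphM fmorphV rmorph_nat.
  by rewrite UE aSds -scalemxAl scalerA /c -mulrA [in RHS]rmorphM rmorph_nat.
(* If [b = 0] then [a = b U = 0], but [a d* = u d d* = u]. *)
have b_neq0 : b != 0.
  apply: contra u0_neq0 => /eqP b0.
  rewrite -(map_mx_eq0 (real_complex R)) -/u -(mulmx1 u) -dds mulmxA -/a -bU b0.
  by rewrite !mul0mx.
(* Here [tau] is one less than the period, so [V] is the inverse of [U]. *)
pose V := U ^+ tau.
have UV : U * V = 1 by rewrite -exprS.
have VU : V * U = 1 by rewrite -exprSr.
have aV : a *m V = b by rewrite -bU -mulmxA [U *m V]UV mulmx1.
have bV : b *m V = c%:C *: b - a.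
  have aE : a *m U *m V = a by rewrite -mulmxA [U *m V]UV mulmx1.
  by rewrite -[a in RHS]aE aU mulmxBl -scalemxAl aV opprB addrC subrK.
have UV2 : U ^+ 2 * V ^+ 2 = 1.
  by rewrite -exprMn_comm ?UV ?expr1n // /GRing.comm UV VU.
have VU2 : V ^+ 2 * U ^+ 2 = 1.
  by rewrite -exprMn_comm ?VU ?expr1n // /GRing.comm UV VU.
(* [b U^2 = c a - b] and [b V^2 = c (c b - a) - b]; the multiples of [a] cancel in the sum. *)
have bz : b *m (U ^+ 2 + V ^+ 2) = (c ^+ 2 - 2)%:C *: b.
  rewrite mulmxDr 2!expr2 -[U * U]/(U *m U) -[V * V]/(V *m V).
  rewrite (mulmxA b U U) (mulmxA b V V) bU aU bV mulmxBl -scalemxAl bV aV.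
  rewrite rmorphB rmorphXn rmorph_nat /= scalerBr scalerA scalerBl -expr2.
  by rewrite scaler_nat mulr2n opprD addrC addrACA addrA addrA subrK -addrA.
have U2 : (U ^+ 2) ^+ tau.+1 = 1 by rewrite -exprM mulnC exprM Utau expr1n.
have [p p_mon] := finite_order_sum_monic_int UV2 VU2 bz b_neq0 U2.
rewrite -[c]/(2 * theta / k%:R) => rp; exists p => //.
rewrite -(fmorph_root (real_complex R)) -map_poly_comp.
rewrite (eq_map_poly (g := intr)) // => x; exact: rmorph_int.
Qed.

(** * Two-regular graphs: permutation of arcs and cycles *)

(** One step of a walk that does not turn back: having entered [y] from [x], leave by another
    neighbour. The default [x] covers dead ends. *)
Definition next_nbr (G : sgraph) (x y : G) : G :=
  odflt x [pick z | adj y z && (z != x)].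

Lemma next_nbrP (G : sgraph) (x y : G) : regular G 2 -> adj x y ->
  next_nbr x y != x /\
  forall z, adj y z = (z == x) || (z == next_nbr x y).
Proof.
move=> reg; rewrite adj_sym => yx.
have /cards2P[a [b [ab Nab]]] : #|[set z | adj y z]| == 2 by apply/eqP/reg.
have Ny z : adj y z = (z == a) || (z == b).
  by have := in_set2 z a b; rewrite -Nab inE.
rewrite /next_nbr; case: pickP => [c /andP[yc cx] | none] /=.
  split=> // z; move: yx yc cx; rewrite !Ny.
  by case/orP => /eqP-> /orP[]/eqP->; rewrite ?eqxx // orbC.
(* If the choice failed, both neighbours of [y] would equal [x]. *)
have := none a; have := none b; move: yx ab; rewrite !Ny !eqxx orbT /=.
by case/orP => /eqP->; rewrite eqxx // eq_sym => ->.
Qed.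

Section TwoRegular.

Variable (G : sgraph).
Hypothesis reg : regular G 2.

Lemma pred_arc_subproof (e : garc G) :
  adj (next_nbr (terminus e) (origin e)) (origin e).
Proof.
rewrite adj_sym; have [_ ->] := next_nbrP reg (arc_inv_subproof e).
by rewrite eqxx orbT.
Qed.

(** The arc before [e] on its cycle; it marks the only nonzero entry, 1, in row [e] of [U]. *)
Definition pred_arc (e : garc G) : garc G :=
  exist (fun p : G * G => adj p.1 p.2)
    (next_nbr (terminus e) (origin e), origin e) (pred_arc_subproof e).

(** For [k = 2] the entry of [U] at [e, f] is [[o(e) = t(f)] - [e^-1 = f]], and this form of the
    test matches it. *)
Lemma pred_arcE (e f : garc G) :
  (pred_arc e == f) = (origin e == terminus f) && (arc_inv e != f).
Proof.
have [ne Ne] := next_nbrP reg (arc_inv_subproof e).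
rewrite -!val_eqE /=; case: f => [[a b] /= ab]; rewrite /terminus /= !xpair_eqE.
have [eb | //] := eqVneq (origin e) b; last by rewrite andbF.
rewrite !andbT; move: ab; rewrite -eb adj_sym Ne.
by case/orP => /eqP->; rewrite ?eqxx ?(negPf ne) // eq_sym ne.
Qed.

Lemma pred_arc_inj : injective pred_arc.
Proof.
move=> e f /eqP; rewrite pred_arcE => /andP[/eqP oe].
have {}oe : origin e = origin f := oe.
have [_ Nf] := next_nbrP reg (arc_inv_subproof f).
rewrite -val_eqE /= xpair_eqE oe eqxx andbT => te.
(* The common origin has two neighbours, and [te] rules out the one other than [terminus f]. *)
have : adj (origin f) (terminus e) by rewrite -oe; exact: (valP e).
rewrite {}Nf (negPf te) orbF => /eqP {}te.
case: e f oe te => [[a b] ?] [[c d] ?] /= oe te.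
by apply: val_inj; congr (_, _).
Qed.

Lemma two_regular_periodic (R : realType) : periodic G R.
Proof.
have sI : injective (fun i : 'I_#|garc G| => enum_rank (pred_arc (enum_val i))).
  by move=> i j /enum_rank_inj/pred_arc_inj/enum_val_inj.
have UE : evolution G R = perm_mx (perm sI).
  apply/matrixP => i j; rewrite mxE.
  rewrite (bigD1 (enum_rank (arc_inv (enum_val i)))) //=.
  rewrite big1 => [|g]; last first.
    rewrite -(inj_eq enum_val_inj) enum_rankK => /negPf ne.
    by rewrite 2!mxE -(inv_eq (@arc_invK G)) eq_sym ne mul0r.
  rewrite !mxE enum_rankK arc_invK eqxx mul1r addr0.
  have := boundary_adjM R (enum_rank (arc_inv (enum_val i))) j reg.
  rewrite mxE enum_rankK => ->.
  (* Degree 2 turns the coefficient [2 / k] into 1. *)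
  rewrite mulVKf ?pnatr_eq0 // permE !(can2_eq (@enum_rankK _) (@enum_valK _)).
  rewrite pred_arcE; have [<- | _] := eqVneq (arc_inv _) (enum_val j).
    by rewrite eqxx subrr andbF.
  by rewrite andbT subr0.
exists #[perm sI]%g; split; first exact: (order_gt0 (perm sI)).
rewrite UE -[RHS]perm_mx1 -(expg_order (perm sI)).
by elim: #[_]%g => [|m IHm]; rewrite ?perm_mx1 // expgS perm_mxM -IHm exprS.
Qed.

(** The iterated state is a pair of consecutive vertices, since the next vertex depends on both. *)
Definition walk (x y : G) (i : nat) : G :=
  (iter i (fun p => (p.2, next_nbr p.1 p.2)) (x, y)).1.

Lemma walkP (x y : G) (i : nat) : adj x y ->
  let w := walk x y in
  [/\ adj (w i) (w i.+1), w i.+2 != w i &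
  forall z, adj (w i.+1) z = (z == w i) || (z == w i.+2)].
Proof.
move=> xy; rewrite /walk /=; set p := iter i _ _.
have pa : adj p.1 p.2.
  rewrite /p; elim: i {p} => //= i IHi.
  by have [_ ->] := next_nbrP reg IHi; rewrite eqxx orbT.
by have [? ?] := next_nbrP reg pa.
Qed.

(** A walk that never turns back first repeats a vertex at its start. The visited vertices are
    closed under adjacency, so by connectivity they are all of [G], and indices along the walk give
    the isomorphism. *)
Lemma two_regular_cycle (n : nat) (n_gt2 : (2 < n)%N) :
  connected_graph G -> #|G| = n -> isomorphic G (cycle_graph n_gt2).
Proof.
move=> [_ conn] nE; case: n / nE n_gt2 => n_gt2.
have /card_gt0P[x0 _] : (0 < #|G|)%N by apply: ltn_trans n_gt2.
have : (0 < #|[set y | adj x0 y]|)%N by rewrite -[#|_|]/(deg x0) reg.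
case/card_gt0P=> x1; rewrite inE => /walkP; set w := walk x0 x1 => wP.
(* Pigeonhole on the first [#|G| + 1] vertices of the walk. *)
have rep : exists p, [exists j : 'I_p, w p == w j].
  have : ~~ injectiveb (fun i : 'I_#|G|.+1 => w i).
    by apply/injectiveP => /leq_card; rewrite card_ord ltnn.
  case/injectivePn => i [j ij wij].
  have [lt | lt | /val_inj eq] := ltngtP i j.
  - by exists j; apply/existsP; exists (Ordinal lt); rewrite /= wij.
  - by exists i; apply/existsP; exists (Ordinal lt); rewrite /= wij.
  - by rewrite eq eqxx in ij.
(* [p.+1] is the first index whose vertex occurred before, so [w 0, ..., w p] are distinct. *)
case: (ex_minnP rep) => -[|p] /existsP[j /eqP wpj] p_min; first by case: j wpj.
have w_neq a b : (a < b)%N -> (b <= p)%N -> w a != w b.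
  move=> ab; apply: contraTN => /eqP wab; rewrite -ltnNge; apply: p_min.
  by apply/existsP; exists (Ordinal ab); rewrite /= wab.
have w_inj a b : (a <= p)%N -> (b <= p)%N -> (w a == w b) = (a == b).
  move=> ap bp; have [->|] := eqVneq a b; first by rewrite eqxx.
  case: ltngtP => // lt _; apply/negbTE; last by rewrite eq_sym w_neq.
  exact: w_neq.
have wS a : w a != w a.+1.
  by have [aw _ _] := wP a; apply: contraTneq aw => <-; rewrite adj_irr.
(* A return to [w j.+1] would make [w p] equal to [w j] or [w j.+2]. The first repeats too early; so
   does the second, unless [p = j.+2], a step back, or [p = j.+1], a loop. *)
have wp0 : w p.+1 = w 0%N.
  have [wp _ _] := wP p; case: j wpj => -[|j] //= jp wpj.
  have [_ _ Nj] := wP j; have [_ nj _] := wP j.+1.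
  move: wp; rewrite wpj adj_sym Nj => /orP[]; first by rewrite w_inj; lia.
  have [j2p | j2p] := leqP j.+2 p.
    by rewrite w_inj // => /eqP pj; rewrite -wpj pj eqxx in nj.
  by have -> : j.+2 = p.+1 by [lia]; rewrite (negPf (wS p)).
have p_gt1 : (1 < p)%N.
  case: p wp0 {w_neq w_inj p_min j wpj} => [|[|p]] // wp0.
    by have [] := wP 0%N; rewrite wp0 adj_irr.
  by have [_] := wP 0%N; rewrite wp0 eqxx.
(* [w 0] is also [w p.+1], with neighbours [w p] and [w p.+2]; as [w 1] is not [w p], it is
   [w p.+2]. *)
have w0N z : adj (w 0%N) z = (z == w p) || (z == w 1%N).
  have [_ _ Np] := wP p; have [w01 _ _] := wP 0%N.
  move: w01; rewrite -wp0 !Np w_inj; try lia.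
  by case: eqP => [|_ /= /eqP->]; first by lia.
have w_surj z : exists2 i, (i <= p)%N & w i = z.
  have cl : closed (@adj G) [pred z | [exists i : 'I_p.+1, w i == z]].
    apply: intro_closed => [|x y xy /existsP[[[|i] ip] /= /eqP wx]].
    - by apply: sym_connect_sym; exact: adj_sym.
    - move: xy; rewrite -wx w0N; case/orP => /eqP->; apply/existsP.
        by exists ord_max.
      by exists (Ordinal (ltnW p_gt1 : 1 < p.+1)%N).
    have [_ _ Ni] := wP i; move: xy; rewrite -wx Ni; case/orP => /eqP->.
      by apply/existsP; exists (Ordinal (ltnW ip)).
    have [i2p | i2p] := leqP i.+2 p.
      by apply/existsP; exists (Ordinal (i2p : i.+2 < p.+1)%N).
    have -> : i.+2 = p.+1 by lia.
    by apply/existsP; exists ord0; rewrite wp0.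
  have := closed_connect cl (conn (w 0%N) z); rewrite !inE.
  have -> : [exists i : 'I_p.+1, w i == w 0%N] by apply/existsP; exists ord0.
  by case/esym/existsP => i /eqP; exists i; rewrite // -ltnS.
have wI : injective (fun i : 'I_p.+1 => w i).
  by move=> a b /eqP; rewrite w_inj; [move/eqP/val_inj | exact: leq_ord..].
have pG : #|G| = p.+1.
  apply/eqP; rewrite -[p.+1]card_ord eqn_leq (leq_card _ wI) andbT.
  rewrite -!cardsT.
  apply: leq_trans (leq_imset_card (fun i : 'I_p.+1 => w i) _).
  apply/subset_leq_card/subsetP => z _; have [i ip <-] := w_surj z.
  exact: (imset_f (fun i : 'I_p.+1 => w i)
    (in_setT (Ordinal (ip : i < p.+1)%N))).
(* Indices wrap around at both ends: [w0N] serves [a = 0], and [wp0] serves [a = p]. *)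
have wadj a b : (a < p.+1)%N -> (b < p.+1)%N ->
    adj (w a) (w b) = (b == a.+1 %% p.+1)%N || (a == b.+1 %% p.+1)%N.
  rewrite !ltnS => ap bp; have modE c : (c <= p)%N ->
      (c.+1 %% p.+1 = if c == p then 0 else c.+1)%N.
    by move=> cp; case: eqP => [->|?]; rewrite ?modnn // modn_small //; lia.
  rewrite !modE //; case: a ap => [|a] ap.
    by rewrite w0N !w_inj //; try (do 2 case: ifP => ?); lia.
  have [_ _ ->] := wP a; rewrite (w_inj _ a) //; last by lia.
  have -> : (w b == w a.+2) = (b == if a.+1 == p then 0 else a.+2)%N.
    case: (a.+1 =P p) => ap1; first by rewrite ap1 wp0 w_inj.
    by rewrite w_inj //; lia.
  by do 2 case: ifP => ?; lia.
rewrite -pG in wadj.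
have hI : injective (fun i : 'I_#|G| => w i).
  by move=> a b /eqP; rewrite w_inj -1?ltnS -1?pG // => /eqP/val_inj.
have [g hK gK] : bijective (fun i : 'I_#|G| => w i).
  by apply: inj_card_bij hI _; rewrite card_ord.
exists g; split=> [|x y]; first exact: Bijective gK hK.
by rewrite -{2}[x]gK -{2}[y]gK wadj.
Qed.

End TwoRegular.

(** * Regularity of [C6], spectral data and the Diophantine equation *)

Lemma isomorphic_regular (G H : sgraph) (k : nat) :
  isomorphic G H -> regular H k -> regular G k.
Proof.
move=> [f [[g fK gK] fE]] reg x; rewrite -(reg (f x)) /deg.
rewrite -(card_imset _ (can_inj fK)); apply: eq_card => y; rewrite !inE -[y]gK.
by rewrite (mem_imset _ _ (can_inj fK)) inE fE.
Qed.

Lemma C6_regular : regular C6 2.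
Proof.
case=> -[|[|[|[|[|[|i]]]]]] i_lt //=; rewrite /deg cardsE -sum1_card big_mkcond;
by rewrite !big_ord_recl big_ord0.
Qed.

(** The adjacency matrix has integer entries, so its characteristic polynomial serves. *)
Lemma monic_int_root_adjmx (G : sgraph) (R : realType) (theta : R) :
  eigenvalue (adjmx G R) theta ->
  exists2 p : {poly int}, p \is monic & root (map_poly intr p) theta.
Proof.
pose A : 'M[int]_#|G| := \matrix_(i, j) (adj (enum_val i) (enum_val j))%:R.
rewrite eigenvalue_root_char => rt; exists (char_poly A).
  exact: char_poly_monic.
rewrite map_char_poly; suff -> : map_mx intr A = adjmx G R by [].
by apply/matrixP => i j; rewrite !mxE rmorph_nat.
Qed.

(** The order of [G] comes from the degree of the characteristic polynomial, the last equation from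
    half the trace of [A^2]. *)
Lemma spectrum_eigenvalue_trace (G : sgraph) (R : realType) (k m : nat)
    (theta : R) :
  (0 < m)%N -> regular G k ->
  adj_spectrum G ([:: k%:R; - k%:R] ++ nseq m theta ++ nseq m (- theta)) ->
  [/\ eigenvalue (adjmx G R) theta, #|G| = m.+1.*2 &
      m.+1%:R * k%:R = k%:R ^+ 2 + m%:R * theta ^+ 2 :> R].
Proof.
move=> m_gt0 reg spec.
have nE : #|G| = m.+1.*2.
  have := size_char_poly (adjmx G R); rewrite spec size_prod_XsubC.
  by rewrite !size_cat !size_nseq => -[<-]; rewrite -addnn /=; lia.
split=> //.
  rewrite eigenvalue_root_char spec root_prod_XsubC !mem_cat mem_nseq.
  by rewrite m_gt0 eqxx /= orbT.
have := mxtrace_sqr_prod spec; rewrite (mxtrace_sqr_adj R reg) nE.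
rewrite !big_cat /= !big_cons big_nil !big_nseq !iter_addr_0 addr0 !sqrrN.
rewrite -addnn natrM natrD -(mulr_natl (theta ^+ 2)) => E.
apply: (@mulfI _ 2%:R); first by rewrite pnatr_eq0.
by move: E; lra.
Qed.

(** As [k > 1], the right side is below [4 m], so [q k < 4]. Hence [q = 1] and [k] is 2 or 3, and
    the equation is linear in [m]. *)
Lemma periodic_degree_card (k m : nat) (q : int) :
  (0 < k)%N -> (0 < m)%N -> k != 1%N -> (0 < q)%R ->
  q * m%:Z * k%:Z = 4 * (m.+1%:Z - k%:Z) ->
  (k = 2%N /\ m = 2%N) \/ (k = 3%N /\ m = 8%N).
Proof.
case: q => [[//|q]|//] k_gt0 m_gt0 k1 _ E.
have qk : (q.+1 * k < 4)%N by nia.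
case: q E qk => [|q] E qk; last by nia.
have [kE|kE] : k = 2%N \/ k = 3%N by lia.
  by rewrite kE in E *; lia.
by rewrite kE in E *; lia.
Qed.

Theorem theorem1p2 (R : realType) (G : sgraph) (n k : nat) (theta : R)
  (hn : #|G| = n)
  (hconn : connected_graph G)
  (hbip : bipartite G)
  (hreg : regular G k)
  (ha : (1 <= n./2 - 1)%N)
  (hdist : uniq [:: k%:R; - k%:R; theta; - theta])
  (hspec : adj_spectrum G
     ([:: k%:R; - k%:R] ++ nseq (n./2 - 1) theta ++ nseq (n./2 - 1) (- theta))) :
  periodic G R <-> isomorphic G C6.
Proof.
split=> [per | iso]; last first.
  exact: two_regular_periodic (isomorphic_regular iso C6_regular) R.
have [eig nE tr] := spectrum_eigenvalue_trace ha hreg hspec.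
move: ha nE tr {hspec}; set m := (n./2 - 1)%N => m_gt0 nE tr.
have m0 : m%:R != 0 :> R by rewrite pnatr_eq0 -lt0n.
move: hdist; rewrite /= !inE !negb_or -!andbA.
case/and5P=> kNk kt kNt Nkt /and3P[NkNt tNt _].
have k_gt0 : (0 < k)%N.
  by rewrite lt0n; apply: contraNneq kNk => ->; rewrite oppr0.
have k0 : k%:R != 0 :> R by rewrite pnatr_eq0 -lt0n.
have t0 : theta != 0 by apply: contraNneq tNt => ->; rewrite oppr0.
have k1 : k != 1%N.
  apply/eqP => k1; rewrite k1 in tr kt kNt.
  have : theta ^+ 2 == 1.
    rewrite -subr_eq0 -(mulrI_eq0 _ (mulfI m0)) mulrBr subr_eq0; apply/eqP.
    by move: tr; rewrite -addn1 natrD; lra.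
  by rewrite sqrf_eq1 => /orP[]/eqP tE; rewrite tE ?opprK eqxx in kt kNt.
have thetaE : theta ^+ 2 = (m.+1%:R * k%:R - k%:R ^+ 2) / m%:R.
  by rewrite tr addrC addKr mulrC mulKf.
have [p p_mon rp] := periodic_eigenvalue k_gt0 hreg per eig.
(* [y + 2] is [(2 theta / k)^2] with [theta^2] replaced by its value from the trace equation. *)
pose y : rat := 4 * (m.+1%:R - k%:R) / (m%:R * k%:R) - 2.
have yE : (2 * theta / k%:R) ^+ 2 - 2 = ratr y.
  rewrite /y rmorphB !rmorphM fmorphV rmorphB rmorphM !rmorph_nat /=.
  by rewrite exprMn exprMn thetaE; field; rewrite k0.
rewrite yE in rp; have [z yz] := monic_int_root_rat p_mon rp.
have qE : (z + 2)%:~R * m%:R * k%:R = 4 * (m.+1%:R - k%:R) :> rat.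
  rewrite rmorphD /= -yz /y.
  by field; rewrite !pnatr_eq0 -!lt0n k_gt0.
have q_gt0 : 0 < z + 2.
  rewrite -(ltr0z R); have -> : (z + 2)%:~R = (2 * theta / k%:R) ^+ 2 :> R.
    by rewrite rmorphD /= -ratr_int -yz -yE subrK.
  rewrite exprn_even_gt0 //= !mulf_eq0 invr_eq0 (negPf t0) (negPf k0).
  by rewrite pnatr_eq0.
have := @periodic_degree_card k m (z + 2) k_gt0 m_gt0 k1 q_gt0.
case=> [|[kE mE]|[kE mE]].
- apply: (@intr_inj rat); rewrite !rmorphM rmorphB /=.
  by rewrite -!pmulrn.
- apply: two_regular_cycle => //; first by rewrite -kE.
  by rewrite nE mE.
have [r r_mon rr] := monic_int_root_adjmx eig.
have t2 : theta ^+ 2 = (3 / 2) ^+ 2.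
  by rewrite thetaE kE mE; field.
(* If [b / 2] is a root of a monic integer polynomial, it is an integer and [b] is even, which fails
   for 3 and -3. *)
have half (b : int) : theta = b%:~R / 2 -> exists a : int, b = 2 * a.
  move=> tE; have tE' : theta = ratr (b%:~R / 2).
    by rewrite tE fmorph_div /= ratr_int rmorph_nat.
  rewrite tE' in rr; have [a aE] := monic_int_root_rat r_mon rr.
  exists a; apply: (@intr_inj rat).
  by rewrite rmorphM /= -aE mulrC divfK.
have /eqP := t2; rewrite eqf_sqr => /orP[]/eqP tE; exfalso.
  have [|a aE] := half 3; first by rewrite rmorph_nat.
  by clear -aE; lia.
have [|a aE] := half (- 3); first by rewrite rmorphN rmorph_nat mulNr.
by clear -aE; lia.
Qed.
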